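(* Let $\rho:\mathsf A^{op}\times\mathsf A\to\mathrm{Set}$ be a bimodule, $\alpha:\mathsf A^{op}\times\mathsf A\to\mathcal C$ a reference bimodule, and $D:\mathrm{el}(\rho)\to\mathcal C$ an element representation. There is a one-to-one correspondence between $D$-algebras as element representations, i.e. morphisms $D\Rightarrow E_\alpha$ of element representations, and $D$-algebras as bimodules, i.e. morphisms $\chi_D\Rightarrow\alpha$ of bimodules.
   Context: $\mathsf A$ is a category and $\mathcal C$ is a category with the colimits needed below. A bimodule is a functor out of $\mathsf A^{op}\times\mathsf A$; a reference bimodule is simply a chosen bimodule $\alpha$ in $\mathcal C$. $\mathrm{el}(\rho)$ is the category of elements of $\rho$ and $\Sigma:\mathrm{el}(\rho)\to\mathsf A^{op}\times\mathsf A$ the projection. An element representation is a functor $\mathrm{el}(\rho)\to\mathcal C$; morphisms are natural transformations. $\chi_D=\mathrm{Lan}_\Sigma D$ is the characteristic bimodule of $D$, and $E_\alpha=\alpha\circ\Sigma:\mathrm{el}(\rho)\to\mathcal C$ is the $\alpha$-reference element representation. *)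

(* Defs.v *)
From mathcomp Require Import all_boot.
From mathcomp Require Import boolp.

Set Implicit Arguments.
Unset Strict Implicit.
Unset Printing Implicit Defensive.

Declare Scope cat_scope.
Delimit Scope cat_scope with cat.
Local Open Scope cat_scope.

Record category := Category {
  ob :> Type;
  hom : ob -> ob -> Type;
  idm : forall a, hom a a;
  compm : forall a b c, hom b c -> hom a b -> hom a c;
  comp1m : forall a b (f : hom a b), compm (idm b) f = f;
  compm1 : forall a b (f : hom a b), compm f (idm a) = f;
  compmA : forall a b c d (h : hom c d) (g : hom b c) (f : hom a b),
    compm h (compm g f) = compm (compm h g) f }.

Arguments hom {_} _ _.
Arguments idm {_} _.
Arguments compm {_ _ _ _} _ _.
Arguments comp1m {_ _ _} _.
Arguments compm1 {_ _ _} _.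
Arguments compmA {_ _ _ _ _} _ _ _.

Notation "g \o f" := (compm g f) : cat_scope.

Record functor (C D : category) := Functor {
  fob :> C -> D;
  fmap : forall a b, hom a b -> hom (fob a) (fob b);
  fmap1 : forall a, fmap (idm a) = idm (fob a);
  fmapM : forall a b c (g : hom b c) (f : hom a b),
    fmap (g \o f) = fmap g \o fmap f }.

Arguments fmap {_ _} _ {_ _} _.
Arguments fmap1 {_ _} _ _.
Arguments fmapM {_ _} _ {_ _ _} _ _.

Record nat_trans (C D : category) (F G : functor C D) := NatTrans {
  component :> forall a, hom (F a) (G a);
  naturality : forall a b (f : hom a b),
    fmap G f \o component a = component b \o fmap F f }.

Arguments naturality {_ _ _ _} _ {_ _} _.

Definition functor_comp (C D E : category) (G : functor D E) (F : functor C D) :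
  functor C E.
Proof.
exists (fun a => G (F a)) (fun a b f => fmap G (fmap F f)).
- by move=> a; rewrite !fmap1.
- by move=> a b c g f; rewrite !fmapM.
Defined.

Definition opposite (C : category) : category.
Proof.
exists C (fun a b => @hom C b a) (fun a => idm a) (fun a b c g f => f \o g).
- by move=> a b f; exact: compm1.
- by move=> a b f; exact: comp1m.
- by move=> a b c d h g f; rewrite compmA.
Defined.

Definition product (C D : category) : category.
Proof.
exists (C * D)%type (fun a b => (hom a.1 b.1 * hom a.2 b.2)%type)
  (fun a => (idm a.1, idm a.2))
  (fun a b c g f => (g.1 \o f.1, g.2 \o f.2)).
- by move=> a b [f1 f2]; rewrite /= !comp1m.
- by move=> a b [f1 f2]; rewrite /= !compm1.
- by move=> a b c d h g f; rewrite /= !compmA.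
Defined.

Definition sets : category :=
  @Category Type (fun X Y => X -> Y) (fun X x => x) (fun X Y Z g f x => g (f x))
    (fun _ _ _ => erefl) (fun _ _ _ => erefl) (fun _ _ _ _ _ _ _ => erefl).

Definition bimodule (A C : category) := functor (product (opposite A) A) C.

Section Elements.
Variables (B : category) (F : functor B sets).

Definition el_hom (x y : {b : B & F b}) :=
  {f : hom (projT1 x) (projT1 y) | fmap F f (projT2 x) = projT2 y}.

Lemma el_hom_inj x y (f g : el_hom x y) : sval f = sval g -> f = g.
Proof. by case: f g => f Hf [g Hg] /= fg; apply: eq_exist. Qed.

Definition el_id x : el_hom x x.
Proof. by exists (idm _); rewrite fmap1. Defined.

Definition el_comp x y z (g : el_hom y z) (f : el_hom x y) : el_hom x z.
Proof.
exists (sval g \o sval f).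
by rewrite fmapM /= (svalP f) (svalP g).
Defined.

Definition elements : category.
Proof.
exists {b : B & F b} el_hom el_id el_comp.
- by move=> x y f; apply: el_hom_inj; exact: comp1m.
- by move=> x y f; apply: el_hom_inj; exact: compm1.
- by move=> x y z t h g f; apply: el_hom_inj; exact: compmA.
Defined.

Definition el_proj : functor elements B.
Proof. by exists (fun x : elements => projT1 x) (fun x y f => sval f). Defined.

End Elements.

(* The comma category K / b. *)
Section Comma.
Variables (E B : category) (K : functor E B) (b : B).

Definition comma_hom (x y : {e : E & hom (K e) b}) :=
  {h : hom (projT1 x) (projT1 y) | projT2 y \o fmap K h = projT2 x}.

Lemma comma_hom_inj x y (f g : comma_hom x y) : sval f = sval g -> f = g.
Proof. by case: f g => f Hf [g Hg] /= fg; apply: eq_exist. Qed.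

Definition comma_id x : comma_hom x x.
Proof. by exists (idm _); rewrite fmap1 compm1. Defined.

Definition comma_comp x y z (g : comma_hom y z) (f : comma_hom x y) :
  comma_hom x z.
Proof.
exists (sval g \o sval f).
by rewrite fmapM compmA (svalP g) (svalP f).
Defined.

Definition comma : category.
Proof.
exists {e : E & hom (K e) b} comma_hom comma_id comma_comp.
- by move=> x y f; apply: comma_hom_inj; exact: comp1m.
- by move=> x y f; apply: comma_hom_inj; exact: compm1.
- by move=> x y z t h g f; apply: comma_hom_inj; exact: compmA.
Defined.

Definition comma_ob (e : E) (f : hom (K e) b) : comma := existT _ e f.

Definition comma_proj : functor comma E.
Proof. by exists (fun x : comma => projT1 x) (fun x y f => sval f). Defined.

End Comma.

Arguments comma_ob {_ _} _ {_ _} _.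

Record cocone (J C : category) (F : functor J C) := Cocone {
  apex : C;
  leg : forall j, hom (F j) apex;
  leg_natural : forall i j (f : hom i j), leg j \o fmap F f = leg i }.

Arguments leg {_ _ _} _ _.
Arguments leg_natural {_ _ _} _ {_ _} _.

Record colimit (J C : category) (F : functor J C) := Colimit {
  colim_cocone :> cocone F;
  colim_desc : forall c : cocone F, hom (apex colim_cocone) (apex c);
  colim_descE : forall (c : cocone F) j,
    colim_desc c \o leg colim_cocone j = leg c j;
  colim_desc_unique : forall (c : cocone F) (u : hom (apex colim_cocone) (apex c)),
    (forall j, u \o leg colim_cocone j = leg c j) -> u = colim_desc c }.

Arguments colim_desc {_ _ _} _ _.
Arguments colim_descE {_ _ _} _ _ _.
Arguments colim_desc_unique {_ _ _} _ {_ _} _.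

(* Pointwise left Kan extension of D along K: on objects,
   Lan_K D b = colim (K / b -> E -> C), for a given choice of these colimits. *)
Section LeftKan.
Variables (E B C : category) (K : functor E B) (D : functor E C).

Definition lan_diagram (b : B) : functor (comma K b) C :=
  functor_comp D (comma_proj K b).

Variable colims : forall b, colimit (lan_diagram b).

Definition lan_cocone b b' (g : hom b b') : cocone (lan_diagram b).
Proof.
exists (apex (colims b'))
  (fun x : comma K b =>
     leg (colims b') (comma_ob K (g \o projT2 x))).
move=> x y f.
have gf : (g \o projT2 y) \o fmap K (sval f) = g \o projT2 x.
  by rewrite -compmA (svalP f).
exact: (@leg_natural _ _ _ (colims b') (comma_ob K (g \o projT2 x))
  (comma_ob K (g \o projT2 y)) (exist _ (sval f) gf)).
Defined.

Definition lan_map b b' (g : hom b b') :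
    hom (apex (colims b)) (apex (colims b')) :=
  colim_desc (colims b) (lan_cocone g).

Lemma lan_mapE b b' (g : hom b b') (x : comma K b) :
  lan_map g \o leg (colims b) x =
  leg (colims b') (comma_ob K (g \o projT2 x)).
Proof. exact: (colim_descE (colims b) (lan_cocone g)). Qed.

Lemma lan_map1 b : lan_map (idm b) = idm (apex (colims b)).
Proof.
apply: esym; apply: (colim_desc_unique _ (c := lan_cocone (idm b))) => -[e f] /=.
by rewrite !comp1m.
Qed.

Lemma lan_mapM a b c (g : hom b c) (f : hom a b) :
  lan_map (g \o f) = lan_map g \o lan_map f.
Proof.
apply: esym; apply: (colim_desc_unique _ (c := lan_cocone (g \o f))) => x.
by rewrite -compmA lan_mapE (lan_mapE g (comma_ob K (f \o projT2 x))) /= compmA.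
Qed.

Definition lan : functor B C :=
  @Functor B C (fun b => apex (colims b)) lan_map lan_map1 lan_mapM.

Definition lan_unit : nat_trans D (functor_comp lan K).
Proof.
exists (fun e => leg (colims (K e)) (comma_ob K (idm (K e)))).
move=> e e' f; rewrite [LHS](lan_mapE (fmap K f) (comma_ob K (idm (K e)))) /=.
have fE : idm (K e') \o fmap K f = fmap K f \o idm (K e).
  by rewrite comp1m compm1.
by rewrite -(@leg_natural _ _ _ (colims (K e')) (comma_ob K (fmap K f \o idm (K e)))
  (comma_ob K (idm (K e'))) (exist _ f fE)).
Defined.

End LeftKan.

Definition element_representation (A C : category) (rho : bimodule A sets) :=
  functor (elements rho) C.

Definition reference_representation (A C : category) (rho : bimodule A sets)
    (alpha : bimodule A C) : element_representation C rho :=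
  functor_comp alpha (el_proj rho).

Section CharacteristicBimodule.
Variables (A C : category) (rho : bimodule A sets).
Variable D : element_representation C rho.
Variable colims : forall x, colimit (lan_diagram (el_proj rho) D x).

Definition characteristic_bimodule : bimodule A C := lan colims.

Definition characteristic_unit :
    nat_trans D (reference_representation rho characteristic_bimodule) :=
  lan_unit colims.

End CharacteristicBimodule.

(* Main.v *)
(** The universal property of the pointwise left Kan extension: every leg of the
    colimit computing [Lan_K D b] is a unit component followed by the action of
    [Lan_K D], so a transformation out of [Lan_K D] is determined by its
    composite with the unit; conversely [phi : D => G K] makes the arrows
    [G f \o phi e], for [f : K e -> b], a cocone on [K / b]. *)

Require Import Defs.
From mathcomp Require Import all_boot.
From mathcomp Require Import boolp.
Local Open Scope cat_scope.

Lemma nat_trans_ext (C D : category) (F G : functor C D) (s t : nat_trans F G) :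
  (forall a, s a = t a) -> s = t.
Proof.
case: s t => [s sN] [t tN] /= st.
have {}st : s = t by apply: functional_extensionality_dep.
by case: _ / st tN => tN; congr NatTrans; exact: Prop_irrelevance.
Qed.

(** Composing [v] with the legs gives a cocone, and both [u] and [v] are mediating arrows for it. *)
Lemma colim_hom_ext (J C : category) (F : functor J C) (L : colimit F) (c : C)
    (u v : hom (apex L) c) :
  (forall j, u \o leg L j = v \o leg L j) -> u = v.
Proof.
move=> uv.
have vN i j (f : hom i j) : (v \o leg L j) \o fmap F f = v \o leg L i.
  by rewrite -compmA leg_natural.
pose vc := @Cocone J C F c (fun j => v \o leg L j) vN.
by rewrite (colim_desc_unique L (c := vc) uv)
  -(colim_desc_unique L (c := vc) (u := v) (fun=> erefl)).
Qed.

Section LanUniversalProperty.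
Variables (E B C : category) (K : functor E B) (D : functor E C).
Variables (colims : forall b, colimit (lan_diagram K D b)) (G : functor B C).

(** The unit is the leg at an identity, and [lan_map f] carries it to the leg at [f \o idm (K e)],
    that is, at [f]. *)
Lemma lan_map_unit (b : B) (x : comma K b) :
  fmap (lan colims) (projT2 x) \o lan_unit colims (projT1 x) =
  leg (colims b) x.
Proof.
case: x => e f.
by rewrite [LHS](lan_mapE colims f (comma_ob K (idm (K e)))) /= compm1.
Qed.

Definition lan_desc_cocone (phi : nat_trans D (functor_comp G K)) (b : B) :
  cocone (lan_diagram K D b).
Proof.
exists (G b) (fun x : comma K b => fmap G (projT2 x) \o phi (projT1 x)).
(* The structure arrow of [x] is factored through that of [y], which leaves the naturality square of
   [phi] at [sval f]. *)
move=> x y f; rewrite -(svalP f) fmapM -!compmA.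
by congr (_ \o _); rewrite [RHS](naturality phi (sval f)).
Defined.

Definition lan_desc (phi : nat_trans D (functor_comp G K)) :
  nat_trans (lan colims) G.
Proof.
exists (fun b => colim_desc (colims b) (lan_desc_cocone phi b)) => b b' g.
(* On the leg at [x] both sides become [fmap G (g \o projT2 x) \o phi (projT1 x)]. *)
apply: colim_hom_ext => x.
rewrite -!compmA (colim_descE _ (lan_desc_cocone phi b)) (lan_mapE colims g x).
rewrite [RHS](colim_descE _ (lan_desc_cocone phi b')
  (comma_ob K (g \o projT2 x))).
by rewrite /= fmapM compmA.
Defined.

Definition lan_restrict (psi : nat_trans (lan colims) G) :
  nat_trans D (functor_comp G K).
Proof.
exists (fun e => psi (K e) \o lan_unit colims e) => e e' f.
rewrite compmA [X in X \o _](naturality psi (fmap K f)) -!compmA.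
by congr (_ \o _); exact: (naturality (lan_unit colims) f).
Defined.

(** At the identity of [K e] the cocone arrow is [fmap G (idm (K e)) \o phi e], which is [phi e]. *)
Lemma lan_descK : cancel lan_desc lan_restrict.
Proof.
move=> phi; apply: nat_trans_ext => e /=.
rewrite [LHS](colim_descE _ (lan_desc_cocone phi (K e))
  (comma_ob K (idm (K e)))).
by rewrite /= fmap1 comp1m.
Qed.

Lemma lan_restrictK : cancel lan_restrict lan_desc.
Proof.
move=> psi; apply: nat_trans_ext => b; apply: colim_hom_ext => x.
rewrite (colim_descE _ (lan_desc_cocone (lan_restrict psi) b)) /=.
(* Naturality moves [psi] to the left of the Kan extension's action, where action and unit combine
   into a leg. *)
rewrite compmA [X in X \o _](naturality psi (projT2 x)) -compmA.
by rewrite lan_map_unit.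
Qed.

End LanUniversalProperty.

Arguments lan_desc {E B C K D} colims {G} phi.
Arguments lan_restrict {E B C K D} colims {G} psi.
Arguments lan_descK {E B C K D} colims {G} x.

Theorem theorem8p6 (A C : category) (rho : bimodule A sets)
    (alpha : bimodule A C) (D : element_representation C rho)
    (colims : forall x : product (opposite A) A,
       colimit (lan_diagram (el_proj rho) D x)) :
  exists2 Phi : nat_trans D (reference_representation rho alpha) ->
                nat_trans (characteristic_bimodule colims) alpha,
    bijective Phi
    & forall (phi : nat_trans D (reference_representation rho alpha))
             (z : elements rho),
        Phi phi (el_proj rho z) \o characteristic_unit colims z = phi z.
Proof.
exists (lan_desc colims).
  exists (lan_restrict colims).
    exact: lan_descK.
  exact: lan_restrictK.
move=> phi z.
(* By definition, [lan_restrict] composes with the unit, so the triangle is [lan_descK] read at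
   [z]. *)
exact: (f_equal (fun s : nat_trans _ _ => s z) (lan_descK colims phi)).
Qed.
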